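(* Let $p$ be a prime, $r\in\mathbb{N}$, $k_1,\ldots,k_r\in\mathbb{Z}$ and $\gamma_1,\ldots,\gamma_r\in\mathbb{Z}_p$. For $s_1,\ldots,s_r\in\mathbb{Z}_p$, the map $$c\mapsto L_{p,r}(s_1,\ldots,s_r;\omega^{k_1},\ldots,\omega^{k_r};\gamma_1,\ldots,\gamma_r;c),$$ defined for $c\in\mathbb{N}_{>1}$ with $(c,p)=1$, is continuously extended to $c\in\mathbb{Z}_p^\times$ as a $p$-adic continuous function. Moreover the extension is uniformly continuous with respect to both parameters $c$ and $(s_j)$. Namely, for any given $\varepsilon>0$, there always exists $\delta>0$ such that $$\left|L_{p,r}(s_1,\ldots,s_r;\omega^{k_1},\ldots,\omega^{k_r};\gamma_1,\ldots,\gamma_r;c)-L_{p,r}(s_1',\ldots,s_r';\omega^{k_1},\ldots,\omega^{k_r};\gamma_1,\ldots,\gamma_r;c')\right|_p<\varepsilon$$ holds for any $c,c'\in\mathbb{Z}_p^\times$ with $|c-c'|_p<\delta$ and $s_j,s_j'\in\mathbb{Z}_p$ with $|s_j-s_j'|_p<\delta$ $(1\leqslant j\leqslant r)$.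
   Context: Put $q=4$ if $p=2$ and $q=p$ if $p\geqslant3$. Let $W=\{\pm1\}$ if $p=2$ and $W=\{\xi\in\mathbb{Z}_p^\times\mid\xi^{p-1}=1\}$ if $p\geqslant3$. Every $x\in\mathbb{Z}_p^\times$ is uniquely $x=\omega(x)\langle x\rangle$ with $\omega(x)\in W$, $\langle x\rangle\in1+q\mathbb{Z}_p$. For $z\in\mathbb{C}_p$ with $|z-1|_p\geqslant1$, $\mathfrak{m}_z$ is the measure on $\mathbb{Z}_p$ with $\mathfrak{m}_z(j+p^N\mathbb{Z}_p)=\frac{z^j}{1-z^{p^N}}$ $(0\leqslant j\leqslant p^N-1)$. For $c\in\mathbb{N}_{>1}$ prime to $p$, $\widetilde{\mathfrak{m}}_c=\sum_{\xi\in\mathbb{C}_p,\,\xi^c=1,\,\xi\neq1}\mathfrak{m}_\xi$; it is a $\mathbb{Z}_p$-valued measure. Integrals of continuous functions are limits of Riemann sums, and on $\mathbb{Z}_p^r$ one uses the product measure. Put $(\mathbb{Z}_p^r)'_{\{\gamma_j\}}=\{(x_j)\in\mathbb{Z}_p^r\mid p\nmid x_1\gamma_1,\ p\nmid(x_1\gamma_1+x_2\gamma_2),\ldots,\ p\nmid\sum_{j=1}^rx_j\gamma_j\}$. The $p$-adic multiple $L$-function is $$L_{p,r}(s_1,\ldots,s_r;\omega^{k_1},\ldots,\omega^{k_r};\gamma_1,\ldots,\gamma_r;c)=\int_{(\mathbb{Z}_p^r)'_{\{\gamma_j\}}}\prod_{i=1}^r\Bigl\langle\sum_{j=1}^ix_j\gamma_j\Bigr\rangle^{-s_i}\omega^{k_i}\Bigl(\sum_{j=1}^ix_j\gamma_j\Bigr)\prod_{j=1}^rd\widetilde{\mathfrak{m}}_c(x_j)$$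 (the zero function if the domain is empty). *)

(* Defs.v *)
From HB Require Import structures.
From mathcomp Require Import all_boot all_order all_algebra.
From mathcomp Require Import all_classical all_reals topology.

Set Implicit Arguments.
Unset Strict Implicit.
Unset Printing Implicit Defensive.

Import Order.TTheory GRing.Theory Num.Theory.

Local Open Scope classical_set_scope.
Local Open Scope ring_scope.

(* C_p is characterized, up to isometric isomorphism of fields, as a field that
   is algebraically closed, complete for a multiplicative ultrametric absolute
   value with |p| = 1/p, and in which the elements algebraic over Q_p are dense;
   Q_p is the closure of Q. (A normedZmodType could not be used: its axiom
   `|x *+ n| = `|x| *+ n fails for p-adic absolute values.) *)
HB.mixin Record isPadicComplex (R : realType) (p : nat) K
    of GRing.ClosedField K & Metric R K & Complete K := {
  pabs : K -> R ;
  mdist_pabs : forall x y : K, mdist x y = pabs (x - y) ;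
  pabsM : forall x y : K, pabs (x * y) = pabs x * pabs y ;
  pabs_ultra : forall x y : K, pabs (x + y) <= Num.max (pabs x) (pabs y) ;
  pabs_p : pabs p%:R = p%:R^-1 ;
  dense_algebraic : dense [set x : K | exists P : {poly K},
    [/\ P != 0, forall i, closure (range (fun a : rat => ratr a : K)) P`_i
      & root P x]]
}.

#[short(type="padicComplexType")]
HB.structure Definition PadicComplex (R : realType) (p : nat) :=
  { K of GRing.ClosedField K & Metric R K & Complete K
       & isPadicComplex R p K }.

Section Padic.
Context {R : realType} {p : nat} {K : padicComplexType R p}.
Implicit Types (x a z : K) (N c : nat).

Definition padic_int : set K := closure (range (fun m : int => m%:~R : K)).

Definition padic_unit : set K := [set x | padic_int x /\ exists2 y, padic_int y & x * y = 1].

Definition pdvd x : Prop := exists2 y, padic_int y & x = p%:R * y.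

Definition padic_q : nat := if p == 2 then 4 else p.

Definition teich_group : set K :=
  if p == 2 then [set 1; -1] else [set xi : K | padic_unit xi /\ xi ^+ p.-1 = 1].

Definition one_units : set K :=
  [set x | exists2 u, padic_int u & x = 1 + padic_q%:R * u].

(* Meaningful on padic_unit only, where such a w exists and is unique. *)
Definition omega x : K :=
  get [set w | teich_group w /\ exists2 a, one_units a & x = w * a].

Definition angle x : K := x / omega x.

(* The power a ^ s for a in 1 + q Z_p and s in Z_p: the value at s of the
   continuous extension to Z_p of n |-> a ^+ n. *)
Definition padic_pow a (s : K) : K :=
  get [set l : K | forall u : nat -> nat,
    ((u n)%:R : K) @[n --> \oo] --> s -> a ^+ u n @[n --> \oo] --> l].

(* A measure mu on Z_p is given by the values mu N j = mu(j + p^N Z_p) for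
   0 <= j < p^N. *)
Definition mu_z z N (j : nat) : K := z ^+ j / (1 - z ^+ (p ^ N)).

Definition mu_tilde c N (j : nat) : K :=
  \sum_(xi \in [set xi : K | xi ^+ c = 1 /\ xi != 1]) mu_z xi N j.

(* Riemann sum of f over D for the product measure mu^r on Z_p^r, along the
   partition into the balls n + p^N Z_p^r with 0 <= n_j < p^N, each ball being
   sampled at n. *)
Definition riemann_sum r (mu : nat -> nat -> K) (D : set ('I_r -> K))
    (f : ('I_r -> K) -> K) N : K :=
  \sum_(n : {ffun 'I_r -> 'I_(p ^ N)} | `[< D (fun j => (n j : nat)%:R) >])
    f (fun j => (n j : nat)%:R) * \prod_(j < r) mu N (n j).

Definition padic_integral r (mu : nat -> nat -> K) (D : set ('I_r -> K))
    (f : ('I_r -> K) -> K) : K :=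
  lim (riemann_sum mu D f N @[N --> \oo]).

Definition partial_dot r (x gamma : 'I_r -> K) (i : 'I_r) : K :=
  \sum_(j < r | (j <= i)%N) x j * gamma j.

Definition Lp_domain r (gamma : 'I_r -> K) : set ('I_r -> K) :=
  [set x : 'I_r -> K | (forall j, padic_int (x j)) /\
           (forall i, ~ pdvd (partial_dot x gamma i))].

Definition Lp r (s : 'I_r -> K) (k : 'I_r -> int) (gamma : 'I_r -> K) c : K :=
  padic_integral (mu_tilde c) (Lp_domain gamma)
    (fun x : 'I_r -> K => \prod_(i < r)
      (padic_pow (angle (partial_dot x gamma i)) (- s i)
       * omega (partial_dot x gamma i) ^ k i)).

End Padic.

(* Main.v *)
(* For a nontrivial [c]-th root of unity [xi], the partial fraction
   [xi^j / (1 - xi^(p^N))] is summed in closed form: if [0 < a <= c] and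
   [a p^N = j] modulo [c], then [mu_tilde c N j = a - (c + 1) / 2]. Writing
   [a p^N = j + c t] with [0 < t <= p^N], the integer [t] only depends on [c]
   modulo [p^N], so the values of the measure are bounded by 1 and Lipschitz in
   [c] with constant [p^(N+1)]. The integrand is 1-Lipschitz in [x] and [s]
   jointly on balls of radius [|q|]: [omega] is constant on them and
   [|a^s - b^t| <= max(|a - b|, |s - t|)] for [a], [b] in [1 + q Z_p]. Hence the
   [N]-th Riemann sum is within [p^(-N)] of the integral uniformly in [c] and
   [s], and it is Lipschitz in [(s, c)]; so the L-function is uniformly
   continuous on a dense set of [c]'s and extends by completeness. *)
Require Import Defs.
From HB Require Import structures.
From mathcomp Require Import all_boot all_order all_algebra.
From mathcomp Require Import all_classical all_reals topology.
From mathcomp Require Import cyclic separable cyclotomic.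
From mathcomp Require Import ring.

Set Implicit Arguments.
Unset Strict Implicit.
Unset Printing Implicit Defensive.

Import Order.TTheory GRing.Theory Num.Theory.

Local Open Scope classical_set_scope.
Local Open Scope ring_scope.

(** * The ultrametric absolute value: integers, convergence, completeness *)

Section AbsoluteValue.
Context (R : realType) (p : nat) (p_prime : prime p) (K : padicComplexType R p).
Implicit Types (x y a b s : K) (e : R).

Lemma pabs_ge0 x : 0 <= pabs x.
Proof. by rewrite -[x]subr0 -mdist_pabs mdist_ge0. Qed.

Lemma pabs_eq0 x : (pabs x == 0) = (x == 0).
Proof.
apply/eqP/eqP => [|->]; last by rewrite -(subrr 0) -mdist_pabs mdistxx.
by rewrite -[x]subr0 -mdist_pabs => /mdist_positivity ->; rewrite subr0.
Qed.

Lemma pabs0 : pabs (0 : K) = 0.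
Proof. by apply/eqP; rewrite pabs_eq0. Qed.

Lemma pabs_gt0 x : (0 < pabs x) = (x != 0).
Proof. by rewrite lt_def pabs_eq0 pabs_ge0 andbT. Qed.

Lemma pabs1 : pabs (1 : K) = 1.
Proof.
have h : pabs (1 : K) != 0 by rewrite pabs_eq0 oner_eq0.
by apply: (mulfI h); rewrite -pabsM !mulr1.
Qed.

Lemma pabs_distC x y : pabs (x - y) = pabs (y - x).
Proof. by rewrite -!mdist_pabs metric_sym. Qed.

Lemma pabsN x : pabs (- x) = pabs x.
Proof. by rewrite -[- x]add0r pabs_distC subr0. Qed.

Lemma pabsX x n : pabs (x ^+ n) = pabs x ^+ n.
Proof. by elim: n => [|n IH]; rewrite ?expr0 ?pabs1// !exprS pabsM IH. Qed.

Lemma pabsV x : pabs x^-1 = (pabs x)^-1.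
Proof.
have [->|x0] := eqVneq x 0; first by rewrite invr0 pabs0 invr0.
have h : pabs x != 0 by rewrite pabs_eq0.
by apply: (mulfI h); rewrite -pabsM !mulfV// pabs1.
Qed.

Lemma pabsD_le x y e : pabs x <= e -> pabs y <= e -> pabs (x + y) <= e.
Proof. by move=> xe ye; apply: (le_trans (pabs_ultra _ _)); rewrite ge_max xe. Qed.

Lemma pabsD_lt x y e : pabs x < e -> pabs y < e -> pabs (x + y) < e.
Proof. by move=> xe ye; apply: (le_lt_trans (pabs_ultra _ _)); rewrite gt_max xe. Qed.

Lemma pabsB_le x y e : pabs x <= e -> pabs y <= e -> pabs (x - y) <= e.
Proof. by move=> xe ye; rewrite pabsD_le// pabsN. Qed.

Lemma pdist_le y x z e : pabs (x - y) <= e -> pabs (y - z) <= e -> pabs (x - z) <= e.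
Proof. by move=> xe ye; rewrite -(subrKA y) pabsD_le. Qed.

Lemma pabs_sum (I : Type) (r : seq I) (P : pred I) (F : I -> K) e :
  0 <= e -> (forall i, P i -> pabs (F i) <= e) -> pabs (\sum_(i <- r | P i) F i) <= e.
Proof.
move=> e0 He; elim/big_ind : _ => //; first by rewrite pabs0.
by move=> x y; apply: pabsD_le.
Qed.

Lemma pabs_prod (I : Type) (r : seq I) (P : pred I) (F : I -> K) :
  pabs (\prod_(i <- r | P i) F i) = \prod_(i <- r | P i) pabs (F i).
Proof. by apply: (big_morph _ pabsM pabs1). Qed.

Lemma pabs_prod_le1 (I : Type) (r : seq I) (P : pred I) (F : I -> K) :
  (forall i, P i -> pabs (F i) <= 1) -> pabs (\prod_(i <- r | P i) F i) <= 1.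
Proof.
move=> HF; rewrite pabs_prod; apply: prodr_ile1 => i /HF Fi.
by rewrite pabs_ge0.
Qed.

Lemma pabs_distM_le x y a b e : pabs x <= 1 -> pabs b <= 1 ->
  pabs (x - y) <= e -> pabs (a - b) <= e -> pabs (x * a - y * b) <= e.
Proof.
move=> x1 b1 xy ab.
have -> : x * a - y * b = x * (a - b) + (x - y) * b by ring.
have e0 : 0 <= e by apply: le_trans xy; apply: pabs_ge0.
apply: pabsD_le; rewrite pabsM.
  by rewrite -[e]mul1r ler_pM ?pabs_ge0.
by rewrite -[e]mulr1 ler_pM ?pabs_ge0.
Qed.

Lemma pabs_dist_prod (I : Type) (r : seq I) (P : pred I) (F G : I -> K) e :
  0 <= e ->
  (forall i, P i -> pabs (F i) <= 1) -> (forall i, P i -> pabs (G i) <= 1) ->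
  (forall i, P i -> pabs (F i - G i) <= e) ->
  pabs (\prod_(i <- r | P i) F i - \prod_(i <- r | P i) G i) <= e.
Proof.
move=> e0 HF HG HFG.
elim: r => [|i r IH]; first by rewrite !big_nil subrr pabs0.
rewrite !big_cons; case: ifP => // Pi.
by apply: pabs_distM_le; [exact: HF|exact: pabs_prod_le1|exact: HFG|].
Qed.

Lemma pabs_dist_exp x y n : pabs x <= 1 -> pabs y <= 1 ->
  pabs (x ^+ n - y ^+ n) <= pabs (x - y).
Proof.
move=> x1 y1; elim: n => [|n IH]; first by rewrite subrr pabs0 pabs_ge0.
by rewrite !exprS pabs_distM_le// pabsX exprn_ile1// pabs_ge0.
Qed.

Lemma pabs_nat_le1 n : pabs (n%:R : K) <= 1.
Proof.
elim: n => [|n IH]; first by rewrite pabs0.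
by rewrite -natr1 pabsD_le// pabs1.
Qed.

Lemma pabs_int_le1 (m : int) : pabs (m%:~R : K) <= 1.
Proof.
case: m => n; first exact: pabs_nat_le1.
by rewrite NegzE rmorphN pabsN; exact: pabs_nat_le1.
Qed.

Lemma p_gt1 : (1 : R) < p%:R.
Proof. by rewrite ltr1n prime_gt1. Qed.

Lemma p_gt0 : (0 : R) < p%:R.
Proof. exact: lt_trans p_gt1. Qed.

Lemma pabs_pX n : pabs ((p ^ n)%:R : K) = p%:R ^- n.
Proof. by rewrite natrX pabsX pabs_p exprVn. Qed.

Lemma pX_gt0 n : (0 : R) < p%:R ^- n.
Proof. by rewrite invr_gt0 exprn_gt0// p_gt0. Qed.

Lemma pX_le m n : (m <= n)%N -> (p%:R ^- n : R) <= p%:R ^- m.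
Proof. by move=> mn; rewrite lef_pV2 ?posrE ?exprn_gt0 ?p_gt0// ler_eXn2l ?p_gt1. Qed.

Lemma pX_lt1 n : (0 < n)%N -> (p%:R ^- n : R) < 1.
Proof. by move=> n0; rewrite invf_lt1 ?exprn_gt0 ?p_gt0// exprn_egt1 ?p_gt1// -lt0n. Qed.

Lemma pX_le1 n : (p%:R ^- n : R) <= 1.
Proof. by rewrite invf_le1 ?exprn_gt0 ?p_gt0// exprn_ege1 ?ltW ?p_gt1. Qed.

Lemma exists_pX_lt e : 0 < e -> exists n, p%:R ^- n < e.
Proof.
(* This [n] exceeds [e^-1], and [p ^ n] exceeds [n]. *)
move=> e0; exists (Num.truncn e^-1).+1.
rewrite invf_plt ?posrE ?exprn_gt0 ?p_gt0//.
apply: (lt_le_trans (truncnS_gt _)).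
rewrite -natrX ler_nat ltnW// ltn_expl ?prime_gt1//.
Qed.

Lemma pabs_nat_dvd k n : (p ^ k %| n)%N -> pabs (n%:R : K) <= p%:R ^- k.
Proof.
case/dvdnP => m ->; rewrite natrM pabsM pabs_pX.
by rewrite ler_piMl ?pabs_nat_le1// ltW// pX_gt0.
Qed.

(** If [n] had absolute value below 1, a Bezout relation [u p - v n = 1] would force [pabs 1 < 1],
    since [p] is small as well. *)
Lemma pabs_coprime n : coprime n p -> pabs (n%:R : K) = 1.
Proof.
rewrite coprime_sym => /(coprimeP _ (prime_gt0 p_prime))[[u v] /= uv].
apply/eqP; rewrite eq_le pabs_nat_le1/= leNgt; apply/negP => n1.
have : pabs (1 : K) < 1; last by rewrite pabs1 ltxx.
have -> : (1 : K) = u%:R * p%:R - v%:R * n%:R.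
  have le : (v * n <= u * p)%N by rewrite ltnW// -subn_gt0 uv.
  by rewrite -!natrM -natrB// uv.
apply: pabsD_lt; rewrite ?pabsN pabsM.
  apply: le_lt_trans (_ : pabs (p%:R : K) < 1).
    by rewrite ler_piMl ?pabs_ge0 ?pabs_nat_le1.
  by rewrite pabs_p invf_lt1 ?p_gt1 ?p_gt0.
by apply: le_lt_trans n1; rewrite ler_piMl ?pabs_ge0 ?pabs_nat_le1.
Qed.

Lemma pabs_nat n : (0 < n)%N -> pabs (n%:R : K) = p%:R ^- logn p n.
Proof.
move=> n0; have [m pm {1}->] := pfactor_coprime p_prime n0.
by rewrite natrM pabsM pabs_pX pabs_coprime 1?coprime_sym// mul1r.
Qed.

Lemma pabs_nat_le k n : (pabs (n%:R : K) <= p%:R ^- k) = (p ^ k %| n)%N.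
Proof.
apply/idP/idP; last exact: pabs_nat_dvd.
have [->|n0] := posnP n; first by rewrite dvdn0.
rewrite pabs_nat// lef_pV2 ?posrE ?exprn_gt0 ?p_gt0//.
by rewrite ler_eXn2l ?p_gt1// pfactor_dvdn.
Qed.

Lemma pabs_natB_le k m n :
  (pabs (m%:R - n%:R : K) <= p%:R ^- k) = (m == n %[mod p ^ k])%N.
Proof.
wlog mn : m n / (n <= m)%N => [h|].
  case: (leqP n m) => [|/ltnW] nm; first exact: h.
  by rewrite pabs_distC eq_sym h.
by rewrite -natrB// pabs_nat_le eqn_mod_dvd.
Qed.

Lemma nat_neq0 n : (0 < n)%N -> (n%:R : K) != 0.
Proof. by move=> n0; rewrite -pabs_gt0 pabs_nat// pX_gt0. Qed.

(** Large inequalities are used because they combine directly with bounds of the form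
    [<= p%:R ^- k]; halving [e] recovers the strict ones. *)
Lemma cvg_pabsP (u : nat -> K) l :
  u n @[n --> \oo] --> l <->
  forall e, 0 < e -> exists N, forall n, (N <= n)%N -> pabs (u n - l) <= e.
Proof.
split=> [/metricType_numDomainType.cvgrPdist_lt h e e0|h].
  have [N _ HN] := h e e0; exists N => n Nn.
  by rewrite pabs_distC -mdist_pabs ltW//; apply: HN.
apply/metricType_numDomainType.cvgrPdist_lt => e e0.
have [N HN] := h (e / 2) (divr_gt0 e0 (ltr0Sn _ _)).
exists N => // n /= Nn; rewrite metric_sym mdist_pabs.
by apply: le_lt_trans (HN n Nn) _; rewrite ltr_pdivrMr// ltr_pMr// ltr1n.
Qed.

Lemma cauchy_pabs (u : nat -> K) :
  (forall e, 0 < e -> exists N, forall n, (N <= n)%N -> pabs (u n - u N) <= e) ->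
  exists l : K, u n @[n --> \oo] --> l.
Proof.
move=> h; apply/(@cvg_ex K); apply: (@cauchy_cvg K); apply: cauchy_exP => e e0.
have [N HN] := h (e / 2) (divr_gt0 e0 (ltr0Sn _ _)).
exists (u N), N => // n /= Nn; rewrite ballEmdist/= metric_sym mdist_pabs.
by apply: le_lt_trans (HN n Nn) _; rewrite ltr_pdivrMr// ltr_pMr// ltr1n.
Qed.

Lemma cvg_pabs_le (u : nat -> K) l x e N :
  u n @[n --> \oo] --> l -> (forall n, (N <= n)%N -> pabs (u n - x) <= e) ->
  pabs (l - x) <= e.
Proof.
move=> ul ux; have e0 : 0 <= e by apply: le_trans (ux N (leqnn N)); apply: pabs_ge0.
apply/ler_addgt0Pl => d d0; have [M HM] := (cvg_pabsP _ _).1 ul d d0.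
apply: (@pdist_le (u (maxn M N))).
  by rewrite pabs_distC (le_trans (HM _ (leq_maxl _ _)))// lerDl.
by rewrite (le_trans (ux _ (leq_maxr _ _)))// lerDr ltW.
Qed.

Lemma pabs_le_eq x y : (forall e, 0 < e -> pabs (x - y) <= e) -> x = y.
Proof.
move=> h; apply/eqP; rewrite -subr_eq0 -pabs_eq0 eq_le pabs_ge0 andbT.
by apply/ler_addgt0Pl => e e0; rewrite addr0 h.
Qed.

End AbsoluteValue.

(** * The ring of p-adic integers, its units and divisibility by powers of p *)

Section PadicIntegers.
Context (R : realType) (p : nat) (p_prime : prime p) (K : padicComplexType R p).
Implicit Types (x y a b s : K) (e : R).

Lemma padic_intP x :
  padic_int x <-> forall e, 0 < e -> exists m : int, pabs (x - m%:~R) <= e.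
Proof.
split=> [h e e0|h].
  have [|_ [[m _ <-]]] := h (ball x e); first exact: nbhsx_ballx e0.
  by rewrite ballEmdist/= mdist_pabs => /ltW; exists m.
move=> B /nbhs_ballP[e /= e0 eB].
have [m hm] := h (e / 2) (divr_gt0 e0 (ltr0Sn _ _)).
exists m%:~R; split; first by exists m.
apply: eB; rewrite ballEmdist/= mdist_pabs.
by apply: le_lt_trans hm _; rewrite ltr_pdivrMr// ltr_pMr// ltr1n.
Qed.

Lemma padic_int_closed x :
  (forall e, 0 < e -> exists2 y, padic_int y & pabs (x - y) <= e) -> padic_int x.
Proof.
move=> h; apply/padic_intP => e e0; have [y /padic_intP/(_ e e0)[m ym] xy] := h e e0.
by exists m; apply: pdist_le ym.
Qed.

Lemma padic_int_int (m : int) : padic_int (m%:~R : K).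
Proof. by apply/padic_intP => e /ltW e0; exists m; rewrite subrr pabs0. Qed.

Lemma padic_int_nat (n : nat) : padic_int (n%:R : K).
Proof. exact: (padic_int_int (m := n)). Qed.

Lemma padic_int0 : padic_int (0 : K).
Proof. by have := @padic_int_nat 0; rewrite mulr0n. Qed.

Lemma padic_int1 : padic_int (1 : K).
Proof. by have := @padic_int_nat 1; rewrite mulr1n. Qed.

Lemma padic_int_le1 x : padic_int x -> pabs x <= 1.
Proof.
move=> /padic_intP/(_ 1 ltr01)[m xm].
by rewrite -[x](subrK m%:~R) pabsD_le// pabs_int_le1.
Qed.

Lemma padic_intD x y : padic_int x -> padic_int y -> padic_int (x + y).
Proof.
move=> /padic_intP zx /padic_intP zy; apply/padic_intP => e e0.
have [m xm] := zx e e0; have [n yn] := zy e e0; exists (m + n).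
by rewrite rmorphD opprD addrACA pabsD_le.
Qed.

Lemma padic_intN x : padic_int x -> padic_int (- x).
Proof.
move=> /padic_intP zx; apply/padic_intP => e e0.
by have [m xm] := zx e e0; exists (- m); rewrite rmorphN -opprD pabsN.
Qed.

Lemma padic_intB x y : padic_int x -> padic_int y -> padic_int (x - y).
Proof. by move=> zx zy; apply: padic_intD => //; apply: padic_intN. Qed.

Lemma padic_intM x y : padic_int x -> padic_int y -> padic_int (x * y).
Proof.
move=> zx zy; have x1 := padic_int_le1 zx.
move: zx zy => /padic_intP zx /padic_intP zy; apply/padic_intP => e e0.
have [m xm] := zx e e0; have [n yn] := zy e e0; exists (m * n).
by rewrite rmorphM pabs_distM_le// pabs_int_le1.
Qed.

Lemma padic_intX x n : padic_int x -> padic_int (x ^+ n).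
Proof.
move=> zx; elim: n => [|n IH]; first by rewrite expr0; exact: padic_int1.
by rewrite exprS; apply: padic_intM.
Qed.

Lemma padic_int_sum (I : Type) (r : seq I) (P : pred I) (F : I -> K) :
  (forall i, P i -> padic_int (F i)) -> padic_int (\sum_(i <- r | P i) F i).
Proof.
move=> h; elim/big_ind : _ => //; first exact: padic_int0.
exact: padic_intD.
Qed.

(** The bound [1 < n] is there so that a natural number close to a p-adic unit can serve as a
    parameter [c] of the measure. *)
Lemma padic_int_approx x k :
  padic_int x -> exists2 n : nat, (1 < n)%N & pabs (x - n%:R) <= p%:R ^- k.
Proof.
move=> /padic_intP/(_ _ (pX_gt0 R p_prime k))[m xm].
have pk0 : (0 < p ^ k)%N by rewrite expn_gt0 prime_gt0.
set P : int := Posz (p ^ k)%N.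
(* Adding [2 p^k] keeps the residue of [m] modulo [p^k] and makes the number exceed 1, even when
   [k = 0]. *)
exists (`|(m %% P)%Z| + p ^ k * 2)%N; first by rewrite ltn_addl// (leq_pmull 2 pk0).
apply: (pdist_le xm).
have -> : (`|(m %% P)%Z| + p ^ k * 2)%:R = ((m %% P)%Z + P * 2)%:~R :> K.
  by rewrite -[in RHS](gez0_abs (modz_ge0 m _)) -?lt0n.
rewrite {1}(divz_eq m P) -intrB.
have -> : (m %/ P)%Z * P + (m %% P)%Z - ((m %% P)%Z + P * 2) =
    P * ((m %/ P)%Z - 2) by ring.

rewrite intrM pabsM -[P%:~R]/((p ^ k)%:R).
by rewrite pabs_pX ler_piMr ?pabs_int_le1// ltW// pX_gt0.
Qed.

(** A natural number within [p^-(k+j)] of [x] is itself divisible by [p^k], and its quotient is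
    within [p^-j] of [x / p^k]; so this quotient lies in the closure of the integers. *)
Lemma padic_int_divX x k : padic_int x -> pabs x <= p%:R ^- k ->
  exists2 y, padic_int y & x = (p ^ k)%:R * y.
Proof.
move=> zx xk; have pk0 : ((p ^ k)%:R : K) != 0.
  by rewrite (nat_neq0 p_prime)// expn_gt0 prime_gt0.
exists (x / (p ^ k)%:R); last by rewrite mulrC divfK.
apply: padic_int_closed => e e0; have [j je] := exists_pX_lt p_prime e0.
have [n _ xn] := padic_int_approx (k + j) zx.
have : pabs (n%:R : K) <= p%:R ^- k.
  by rewrite -[n%:R](subKr x) pabsB_le// (le_trans xn)// pX_le// leq_addr.
rewrite pabs_nat_le// => /dvdnP[m nE]; exists m%:R; first exact: padic_int_nat.
have -> : x / (p ^ k)%:R - m%:R = (x - n%:R) / (p ^ k)%:R.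
  by rewrite nE natrM mulrBl mulfK.
rewrite pabsM pabsV pabs_pX ler_pdivrMr ?pX_gt0//.
by rewrite mulrC (le_trans xn)// exprD invfM ler_wpM2l ?ltW// pX_gt0.
Qed.

(** The value group is discrete: a natural number congruent to [x] modulo [p] is also of absolute
    value below 1, hence a multiple of [p]. *)
Lemma padic_int_lt1 x : padic_int x -> pabs x < 1 -> pabs x <= p%:R^-1.
Proof.
move=> zx x1; have [n _ xn] := padic_int_approx 1 zx.
have n1 : pabs (n%:R : K) < 1.
  by rewrite -[n%:R](subKr x) pabsD_lt// pabsN (le_lt_trans xn)// pX_lt1.
have pn : (p %| n)%N.
  apply: contraTT n1; rewrite -prime_coprime// coprime_sym => /pabs_coprime ->//.
  by rewrite ltxx.
by rewrite -[x](subrK n%:R) pabsD_le// -[p%:R]expr1 pabs_nat_dvd// expn1.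
Qed.

Lemma padic_int_coprime x n k : (0 < k)%N ->
  pabs x = 1 -> pabs (x - n%:R) <= p%:R ^- k -> coprime n p.
Proof.
move=> k0 x1 xn; rewrite coprime_sym prime_coprime//; apply/negP => pn.
suff : pabs x < 1 by rewrite x1 ltxx.
rewrite -[x](subrK n%:R) pabsD_lt// ?(le_lt_trans xn)// ?pX_lt1//.
by rewrite (le_lt_trans (@pabs_nat_dvd _ _ p_prime _ 1 _ _))// ?expn1// pX_lt1.
Qed.

(** If [n] is close to [x] and [m] inverts [n] modulo a power of [p], then [m] is close to [x^-1],
    because [x^-1 - m] and [1 - x m] have the same absolute value. *)
Lemma padic_intV x : padic_int x -> pabs x = 1 -> padic_int x^-1.
Proof.
move=> zx x1; have x0 : x != 0 by rewrite -pabs_gt0 x1.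
apply: padic_int_closed => e e0; have [j je] := exists_pX_lt p_prime e0.
have [n _ xn] := padic_int_approx j.+1 zx.
have np := padic_int_coprime (ltn0Sn j) x1 xn.
have := np; rewrite -(@coprime_pexpr j.+1)// => npj.
have pj0 : (0 < p ^ j.+1)%N by rewrite expn_gt0 prime_gt0.
have : (exists m : nat, m * n = 1 %[mod p ^ j.+1])%N.
  move: (npj) => /(coprimeP _ _) [|[u v] /= uv].
    by case: (n) np => //; rewrite /coprime gcd0n; case: (p) p_prime => // -[].
  exists u; rewrite -[(u * n)%N](@subnK (v * p ^ j.+1)) ?uv; last first.
    by rewrite ltnW// -subn_gt0 uv.
  by rewrite addnC modnMDl.
case=> m mn; exists m%:R; first exact: padic_int_nat.
have -> : x^-1 - m%:R = x^-1 * (1 - x * m%:R) by rewrite mulrBr mulr1 mulKf.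
rewrite pabsM pabsV x1 invr1 mul1r.
apply: (@pdist_le _ _ _ ((m * n)%:R)).
  have /eqP := mn; rewrite -(pabs_natB_le p_prime K) pabs_distC => /le_trans; apply.
  by rewrite (le_trans (pX_le _ _ (leqnSn j)))// ltW.
rewrite natrM [x * _]mulrC -mulrBr pabsM pabs_distC.
rewrite (le_trans (ler_piMl (pabs_ge0 _) (pabs_nat_le1 _ _)))//.
by rewrite (le_trans xn)// (le_trans (pX_le _ _ (leqnSn j)))// ltW.
Qed.

Lemma padic_unitP x : padic_unit x <-> padic_int x /\ pabs x = 1.
Proof.
split=> [[zx [y zy xy]]|[zx x1]]; split => //.
  apply/eqP; rewrite eq_le padic_int_le1//=.
  by rewrite -[leLHS](pabs1 K) -xy pabsM ler_piMr ?pabs_ge0// padic_int_le1.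
exists x^-1; first exact: padic_intV.
by rewrite mulfV// -pabs_gt0 x1.
Qed.

Lemma pdvdPn x : padic_int x -> (~ pdvd x) <-> pabs x = 1.
Proof.
move=> zx; split=> [px|x1 [y zy xy]].
  apply/eqP; rewrite eq_le padic_int_le1//= leNgt; apply/negP => x1.
  apply: px; have := padic_int_lt1 zx x1; rewrite -[p%:R]expr1.
  by move=> /(padic_int_divX zx); rewrite expn1.
move: x1; rewrite xy pabsM pabs_p => h.
have : p%:R^-1 * pabs y < 1; last by rewrite h ltxx.
have pV0 : 0 <= (p%:R^-1 : R) by rewrite invr_ge0 ler0n.
rewrite (le_lt_trans (ler_piMr pV0 (padic_int_le1 zy)))//.
by rewrite invf_lt1 ?p_gt1 ?p_gt0.
Qed.

End PadicIntegers.

(** * The Teichmuller character and the projection to one-units *)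

Section Teichmuller.
Context (R : realType) (p : nat) (p_prime : prime p) (K : padicComplexType R p).
Implicit Types (x y a b w s : K) (e : R).

Lemma pabs_near x y : pabs (x - y) < pabs y -> pabs x = pabs y.
Proof.
move=> xy; apply/eqP; rewrite eq_le; apply/andP; split.
  by rewrite -[x](subrK y) pabsD_le// ltW.
rewrite leNgt; apply/negP => yx; suff : pabs y < pabs y by rewrite ltxx.
by rewrite -[X in pabs X < _](subKr x) pabsD_lt// pabsN.
Qed.

(** The cofactor of [a - b] in [a^p - b^p] is a sum of [p] terms, each within [1/p] of [b^(p-1)],
    and [p b^(p-1)] is itself of size at most [1/p]. *)
Lemma pabs_dist_expp a b : pabs a <= 1 -> pabs b <= 1 ->
  pabs (a - b) <= p%:R^-1 -> pabs (a ^+ p - b ^+ p) <= p%:R^-1 * pabs (a - b).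
Proof.
move=> a1 b1 ab; rewrite subrXX pabsM mulrC ler_wpM2r ?pabs_ge0//.
set S := (X in pabs X).
have X1 c n : pabs c <= 1 -> pabs (c ^+ n) <= 1.
  by move=> c1; rewrite pabsX exprn_ile1// pabs_ge0.
rewrite -[S](subrK (\sum_(i < p) b ^+ (p.-1 - i) * b ^+ i)) pabsD_le//.
  rewrite -sumrB pabs_sum ?invr_ge0// => i _.
  rewrite pabs_distM_le ?X1// ?(le_trans (pabs_dist_exp _ _ _))//.
  by rewrite subrr pabs0 invr_ge0.
rewrite (eq_bigr (fun=> b ^+ p.-1)) => [|i _]; last first.
  by rewrite -exprD subnK// -ltnS prednK// prime_gt0.
rewrite sumr_const card_ord -[X in pabs X]mulr_natl pabsM pabs_p.
by rewrite ler_piMr ?X1// invr_ge0.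
Qed.

Lemma pabs_dist_exppX a b n : pabs a <= 1 -> pabs b <= 1 ->
  pabs (a - b) <= p%:R^-1 ->
  pabs (a ^+ (p ^ n) - b ^+ (p ^ n)) <= p%:R ^- n * pabs (a - b).
Proof.
move=> a1 b1 ab; elim: n => [|n IH]; first by rewrite !expr1 expr0 invr1 mul1r.
have X1 c m : pabs c <= 1 -> pabs (c ^+ m) <= 1.
  by move=> c1; rewrite pabsX exprn_ile1// pabs_ge0.
rewrite expnSr !exprM (le_trans (pabs_dist_expp _ _ _)) ?X1//.
  by rewrite (le_trans IH)// (le_trans _ ab)// ler_piMl ?pabs_ge0// pX_le1.
by rewrite exprS invfM -mulrA ler_wpM2l// invr_ge0.
Qed.

Lemma padic_fermat x : padic_int x -> pabs (x ^+ p - x) <= p%:R^-1.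
Proof.
move=> zx; have [n _ xn] := padic_int_approx p_prime 1 zx.
have x1 := padic_int_le1 zx.
apply: (@pdist_le _ _ _ (n%:R ^+ p)).
  by rewrite (le_trans (pabs_dist_exp _ x1 _)) ?pabs_nat_le1.
apply: (@pdist_le _ _ _ n%:R); last by rewrite pabs_distC.
rewrite -natrX -[p%:R]expr1 (pabs_natB_le p_prime) expn1.
by apply/eqP; exact: fermat_little.
Qed.

(** The exponent of [p] in [q]: the boolean counts as 1 for [p = 2] and as 0 otherwise. *)
Definition q_exp : nat := (p == 2)%N.+1.

Lemma padic_qE : @padic_q p = (p ^ q_exp)%N.
Proof. by rewrite /padic_q /q_exp; case: eqP => [->|_]; rewrite ?expn1. Qed.

Lemma pabs_q : pabs ((@padic_q p)%:R : K) = p%:R ^- q_exp.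
Proof. by rewrite padic_qE pabs_pX. Qed.

Lemma one_unitsP a : one_units a <-> padic_int a /\ pabs (a - 1) <= p%:R ^- q_exp.
Proof.
split=> [[u zu ->]|[za a1]].
  split; first by apply: padic_intD; [exact: padic_int1|apply: padic_intM; [exact: padic_int_nat|]].
  rewrite addrAC subrr add0r pabsM pabs_q ler_piMr ?padic_int_le1//.
  by rewrite ltW// pX_gt0.
have zb : padic_int (a - 1) by apply: padic_intB => //; exact: padic_int1.
have [u zu ua] := padic_int_divX p_prime zb a1; exists u => //.
by rewrite padic_qE -ua addrC subrK.
Qed.

Lemma teich_group_unit w : teich_group w -> padic_int w /\ pabs w = 1.
Proof.
rewrite /teich_group; case: eqP => _ /=; last by move=> [/(padic_unitP p_prime)].
have z1 : padic_int (1 : K) by exact: padic_int1.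
by move=> [] ->; rewrite ?pabsN pabs1; split => //; exact: padic_intN.
Qed.

(** For [p = 2], the elements 1 and -1 are at distance [1/2 > 1/4]. Otherwise [w^p = w], while
    raising to the power [p] shrinks the distance by [1/p], so the distance is 0. *)
Lemma teich_group_inj w w' : teich_group w -> teich_group w' ->
  pabs (w - w') <= p%:R ^- q_exp -> w = w'.
Proof.
move=> tw tw'; have [zw _] := teich_group_unit tw; have [zw' _] := teich_group_unit tw'.
move: tw tw'; rewrite /teich_group /q_exp; case: eqP => [p2|_] /=.
  have two : (pabs (1 + 1 : K) <= p%:R ^- 2) = false.
    have -> : (1 + 1 : K) = p%:R := esym (congr1 (fun n => n%:R) p2).
    rewrite pabs_p -[p%:R^-1]/(p%:R ^- 1); apply/negbTE; rewrite -ltNge.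
    by rewrite ltf_pV2 ?posrE ?exprn_gt0 ?p_gt0// ltr_eXn2l ?p_gt1.
  move=> [] -> [] -> //; first by rewrite opprK two.
  by rewrite -opprD pabsN two.
move=> [uw w1] [uw' w'1]; rewrite expr1 => ww'.
have wp (v : K) : v ^+ p.-1 = 1 -> v ^+ p = v.
  move=> v1; have -> : v ^+ p = v * v ^+ p.-1 by rewrite -exprS prednK ?prime_gt0.
  by rewrite v1 mulr1.
have := pabs_dist_expp (padic_int_le1 zw) (padic_int_le1 zw') ww'.
rewrite !wp// => h; apply/eqP; rewrite -subr_eq0 -pabs_eq0 eq_le pabs_ge0 andbT leNgt.
apply/negP => ww0; move: h; rewrite ler_pMl// leNgt invf_lt1 ?p_gt1 ?p_gt0//.
Qed.

(** For [p = 2] an odd number is 1 or -1 modulo 4. Otherwise the representative is the limit of the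
    powers [x^(p^n)]. *)
Lemma teich_near x : padic_int x -> pabs x = 1 ->
  exists2 w : K, teich_group w & pabs (x - w) <= p%:R ^- q_exp.
Proof.
move=> zx x1; rewrite /teich_group /q_exp; case: eqP => [p2|_].
  have [n _ xn] := padic_int_approx p_prime 2 zx.
  have cn := padic_int_coprime p_prime (ltn0Sn 1) x1 xn.
  have {}p2 : p = 2%N := p2.
  have on : odd n by rewrite -coprimen2 -p2.
  have [n1|n3] : (n == 1 %[mod 4] \/ 4 %| n + 1)%N.
  - have : (n %% 4 < 4)%N by rewrite ltn_mod.
    have : odd (n %% 4) by rewrite odd_mod.
    rewrite /dvdn -modnDml.
    by case: (n %% 4)%N => [|[|[|[|?]]]] //; [left|right].
  - exists 1; first by left.
    apply: (pdist_le xn); rewrite -[X in _ - X]/(1%:R : K) (pabs_natB_le p_prime).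
    by rewrite p2.
  - exists (-1); first by right.
    apply: (pdist_le xn); rewrite opprK -[X in _ + X]/(1%:R : K) -natrD.
    by rewrite pabs_nat_le// p2.
pose u n := x ^+ (p ^ n).
have xl1 := padic_int_le1 zx.
have zu n : padic_int (u n) by exact: padic_intX.
(* By Fermat [x^p] and [x] are within [1/p]; each further power [p] gains another factor [1/p]. *)
have step n : pabs (u n.+1 - u n) <= p%:R ^- n.+1.
  rewrite /u expnS exprM (le_trans (pabs_dist_exppX _ _ _ _)) ?padic_fermat//.
    by rewrite pabsX exprn_ile1// pabs_ge0.
  by rewrite exprSr invfM ler_wpM2l ?padic_fermat// ltW// pX_gt0.
have uN N n : (N <= n)%N -> pabs (u n - u N) <= p%:R ^- N.+1.
  elim: n => [|n IH]; first by rewrite leqn0 => /eqP ->; rewrite subrr pabs0 ltW// pX_gt0.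
  rewrite leq_eqVlt => /orP[/eqP ->|]; first by rewrite subrr pabs0 ltW// pX_gt0.
  rewrite ltnS => Nn; apply: (@pdist_le _ _ _ (u n)); last exact: IH.
  by rewrite (le_trans (step n))// pX_le.
have [|w uw] := @cauchy_pabs _ _ K u.
  move=> e e0; have [N Ne] := exists_pX_lt p_prime e0; exists N => n /uN/le_trans; apply.
  by rewrite (le_trans _ (ltW Ne))// pX_le.
have xw : pabs (w - x) <= p%:R^-1.
  apply: (cvg_pabs_le (N := 0%N) uw) => n /uN.
  by rewrite /u expn0 !expr1.
have w1 : pabs w = 1.
  by rewrite -x1; apply: pabs_near; rewrite x1 (le_lt_trans xw)// -[p%:R]expr1 pX_lt1.
have zw : padic_int w.
  apply: padic_int_closed => e e0; have [N HN] := (cvg_pabsP _ _).1 uw e e0.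
  by exists (u N) => //; rewrite pabs_distC HN.
exists w; last by rewrite pabs_distC.
split; first by apply/(padic_unitP p_prime).
(* The sequence of the [u n ^+ p] is [u] shifted by one, so it has the same limit. *)
have wp : w ^+ p = w.
  apply: pabs_le_eq => e e0; have [N HN] := (cvg_pabsP _ _).1 uw e e0.
  apply: (@pdist_le _ _ _ (u N.+1)); last by rewrite HN.
  rewrite /u expnSr exprM pabs_distC (le_trans (pabs_dist_exp _ _ _)) ?w1 ?HN//.
  exact: (padic_int_le1 (@zu N)).
have w0 : w != 0 by rewrite -pabs_gt0 w1.
by apply: (mulfI w0); rewrite -exprS prednK ?prime_gt0// mulr1.
Qed.

(** The choice in [omega] is not vacuous: for the [w] of [teich_near], the quotient [x / w] is a
    one-unit. *)
Lemma omegaP x : padic_int x -> pabs x = 1 ->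
  [/\ teich_group (omega x), padic_int (angle x) & pabs (angle x - 1) <= p%:R ^- q_exp].
Proof.
move=> zx x1; have [w tw xw] := teich_near zx x1.
have [zw w1] := teich_group_unit tw; have w0 : w != 0 by rewrite -pabs_gt0 w1.
have : [set w | teich_group w /\ exists2 a, one_units a & x = w * a] (omega x).
  apply: getPex; exists w; split => //; exists (x / w); last by rewrite mulrC divfK.
  apply/one_unitsP; split; first by apply: padic_intM => //; apply: padic_intV.
  rewrite -(divff w0) -mulrBl pabsM pabsV w1 invr1 mulr1//.
case=> to [a /one_unitsP[za a1] xE]; have [zo o1] := teich_group_unit to.
have o0 : omega x != 0 by rewrite -pabs_gt0 o1.
suff -> : angle x = a by [].
by rewrite /angle {1}xE mulrC mulKf.
Qed.

Lemma pabs_omega x : padic_int x -> pabs x = 1 -> pabs (omega x) = 1.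
Proof. by move=> zx x1; have [/teich_group_unit[]] := omegaP zx x1. Qed.

(** Each Teichmuller value is within [|q|] of its argument, so the two are within [|q|] of each
    other and [teich_group_inj] applies. *)
Lemma omega_near x y : padic_int x -> pabs x = 1 -> padic_int y -> pabs y = 1 ->
  pabs (x - y) <= p%:R ^- q_exp -> omega x = omega y.
Proof.
move=> zx x1 zy y1 xy; have [tx ax1 ax] := omegaP zx x1; have [ty _ ay] := omegaP zy y1.
have near (z : K) : padic_int z -> pabs z = 1 -> pabs (angle z - 1) <= p%:R ^- q_exp ->
    pabs (z - omega z) <= p%:R ^- q_exp.
  move=> zz z1; have oz := pabs_omega zz z1.
  have o0 : omega z != 0 by rewrite -pabs_gt0 oz.
  by rewrite /angle -(divff o0) -mulrBl pabsM pabsV oz invr1 mulr1.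
apply: teich_group_inj => //.
apply: (@pdist_le _ _ _ x); first by rewrite pabs_distC near.
by apply: (pdist_le xy); apply: near.
Qed.

Lemma angle_dist x y : padic_int x -> pabs x = 1 -> padic_int y -> pabs y = 1 ->
  pabs (x - y) <= p%:R ^- q_exp -> pabs (angle x - angle y) = pabs (x - y).
Proof.
move=> zx x1 zy y1 xy; rewrite /angle (omega_near zx x1 zy y1 xy).
by rewrite -mulrBl pabsM pabsV pabs_omega// invr1 mulr1.
Qed.

End Teichmuller.

(** * Powers of one-units with p-adic exponents *)

Section Power.
Context (R : realType) (p : nat) (p_prime : prime p) (K : padicComplexType R p).
Implicit Types (x y a b w s t : K) (e : R).

(** With [n = m p^v] and [m] prime to [p], the power [a^m] is still within [1/p] of 1, and raising
    to the power [p^v] contracts this distance by [p^-v = |n|]. *)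
Lemma pabs_expB1 a n : pabs a <= 1 -> pabs (a - 1) <= p%:R^-1 ->
  pabs (a ^+ n - 1) <= pabs (n%:R : K).
Proof.
move=> a1 aq; have [->|n0] := posnP n; first by rewrite subrr pabs0.
have [m pm nE] := pfactor_coprime p_prime n0.
rewrite [pabs n%:R]pabs_nat// {1}nE exprM -(expr1n K (p ^ logn p n)).
have ham : pabs (a ^+ m - 1) <= p%:R^-1.
  by rewrite -(expr1n K m) (le_trans (pabs_dist_exp _ _ _))// pabs1.
rewrite (le_trans (pabs_dist_exppX p_prime _ _ _ ham)) ?pabs1//.
  by rewrite pabsX exprn_ile1// pabs_ge0.
rewrite ler_piMr ?(le_trans ham)//; first by rewrite ltW// pX_gt0.
by rewrite -[p%:R]expr1 pX_le1.
Qed.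

Lemma pabs_expB a m n : pabs a <= 1 -> pabs (a - 1) <= p%:R^-1 ->
  pabs (a ^+ m - a ^+ n) <= pabs (m%:R - n%:R : K).
Proof.
move=> a1 aq; wlog nm : m n / (n <= m)%N => [h|].
  case: (leqP n m) => [|/ltnW] nm; first exact: h.
  by rewrite pabs_distC [leRHS]pabs_distC h.
rewrite -natrB// -{1}(subnK nm) exprD -{2}[a ^+ n]mul1r -mulrBl pabsM.
rewrite (le_trans _ (pabs_expB1 _ a1 aq))// ler_piMr ?pabs_ge0//.
by rewrite pabsX exprn_ile1// pabs_ge0.
Qed.

(** By [pabs_expB] the map [n |-> a^n] is 1-Lipschitz for the p-adic distance. Hence powers along a
    sequence tending to [s] converge, to a limit common to all such sequences, and the bound passes
    to it. *)
Lemma padic_pow_approx a s n : pabs a <= 1 -> pabs (a - 1) <= p%:R^-1 ->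
  padic_int s -> pabs (padic_pow a s - a ^+ n) <= pabs (s - n%:R).
Proof.
move=> a1 aq zs.
have /choice[u us] : forall k, exists n : nat, pabs (s - n%:R) <= p%:R ^- k.
  by move=> k; have [m _ sm] := padic_int_approx p_prime k zs; exists m.
have u_s : ((u n)%:R : K) @[n --> \oo] --> s.
  apply/cvg_pabsP => e e0; have [N Ne] := exists_pX_lt p_prime e0.
  exists N => k Nk; rewrite pabs_distC (le_trans (us k))// (le_trans _ (ltW Ne))//.
  exact: pX_le.
have [|l ul] := @cauchy_pabs _ _ K (fun k => a ^+ u k).
  move=> e e0; have [N Ne] := (cvg_pabsP _ _).1 u_s e e0; exists N => k Nk.
  rewrite (le_trans (pabs_expB _ _ a1 aq))//; apply: (@pdist_le _ _ _ s).
    exact: Ne.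
  by rewrite pabs_distC Ne.
have pow_lim : [set l : K | forall u : nat -> nat,
    ((u n)%:R : K) @[n --> \oo] --> s -> a ^+ u n @[n --> \oo] --> l]
    (padic_pow a s).
  apply: getPex; exists l => v v_s; apply/cvg_pabsP => e e0.
  have [N1 H1] := (cvg_pabsP _ _).1 u_s e e0.
  have [N2 H2] := (cvg_pabsP _ _).1 v_s e e0.
  have [N3 H3] := (cvg_pabsP _ _).1 ul e e0.
  (* One fixed index of [u] suffices, large enough for [u] to be near [s] and for its power to be
     near [l]. *)
  exists N2 => k Nk; apply: (@pdist_le _ _ _ (a ^+ u (maxn N1 N3))); last first.
    by rewrite H3// leq_maxr.
  rewrite (le_trans (pabs_expB _ _ a1 aq))//; apply: (@pdist_le _ _ _ s).
    exact: H2.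
  by rewrite pabs_distC H1// leq_maxl.
have {}pow_lim := pow_lim u u_s.
apply/ler_addgt0Pl => d d0.
have [N1 H1] := (cvg_pabsP _ _).1 u_s d d0.
apply: (cvg_pabs_le (N := N1) pow_lim) => k Nk.
rewrite (le_trans (pabs_expB _ _ a1 aq))//; apply: (@pdist_le _ _ _ s).
  by rewrite (le_trans (H1 _ Nk))// lerDl pabs_ge0.
by rewrite lerDr ltW.
Qed.

(** One natural exponent [n] very close to [s] serves both bases: [a^s] is near [a^n], then [b^n],
    then [b^t]. *)
Lemma padic_pow_dist a b s t e : pabs a <= 1 -> pabs (a - 1) <= p%:R^-1 ->
  pabs b <= 1 -> pabs (b - 1) <= p%:R^-1 -> padic_int s -> padic_int t ->
  pabs (a - b) <= e -> pabs (s - t) <= e -> pabs (padic_pow a s - padic_pow b t) <= e.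
Proof.
move=> a1 aq b1 bq zs zt ab st; have e0 : 0 <= e by apply: le_trans ab; apply: pabs_ge0.
apply/ler_addgt0Pl => d d0; have [N Nd] := exists_pX_lt p_prime d0.
have [n _ sn] := padic_int_approx p_prime N zs.
have snd : pabs (s - n%:R) <= d + e.
  by rewrite (le_trans sn)// (le_trans (ltW Nd))// lerDl.
apply: (@pdist_le _ _ _ (a ^+ n)).
  by rewrite (le_trans (padic_pow_approx _ _ _ _)).
apply: (@pdist_le _ _ _ (b ^+ n)).
  by rewrite (le_trans (pabs_dist_exp _ _ _))// (le_trans ab)// lerDr ltW.
rewrite pabs_distC (le_trans (padic_pow_approx _ _ _ _))//.
by apply: (@pdist_le _ _ _ s) => //; rewrite pabs_distC (le_trans st)// lerDr ltW.
Qed.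

Lemma padic_pow_le1 a s : pabs a <= 1 -> pabs (a - 1) <= p%:R^-1 ->
  padic_int s -> pabs (padic_pow a s) <= 1.
Proof.
(* Comparison with the exponent 0 bounds [a^s - 1] by [|s| <= 1]. *)
move=> a1 aq zs; rewrite -[padic_pow a s](subrK (a ^+ 0)) pabsD_le//.
  rewrite (le_trans (padic_pow_approx 0 a1 aq zs))// subr0.
  exact: padic_int_le1.
by rewrite expr0 pabs1.
Qed.

End Power.

(** * Boundedness and Lipschitz continuity of the integrand *)

Section Integrand.
Context (R : realType) (p : nat) (p_prime : prime p) (K : padicComplexType R p).
Context (r : nat) (k : 'I_r -> int) (gamma : 'I_r -> K).
Context (gammaZp : forall j, padic_int (gamma j)).
Implicit Types (x y s t : 'I_r -> K) (e : R).

Definition Lp_integrand s x : K :=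
  \prod_(i < r) (padic_pow (angle (partial_dot x gamma i)) (- s i)
                 * omega (partial_dot x gamma i) ^ k i).

(** Extension of the integrand by 0, so that Riemann sums range over all residues and sample points
    can be moved freely. *)
Definition Lp_weight s x : K :=
  if `[< Lp_domain gamma x >] then Lp_integrand s x else 0.

Lemma partial_dot_int x i : (forall j, padic_int (x j)) ->
  padic_int (partial_dot x gamma i).
Proof. by move=> zx; apply: padic_int_sum => j _; apply: padic_intM. Qed.

Lemma partial_dot_dist x y e i : 0 <= e -> (forall j, pabs (x j - y j) <= e) ->
  pabs (partial_dot x gamma i - partial_dot y gamma i) <= e.
Proof.
move=> e0 xy; rewrite -sumrB pabs_sum// => j _.
rewrite -mulrBl pabsM -[e]mulr1 ler_pM ?pabs_ge0//.
by apply: padic_int_le1.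
Qed.

Lemma Lp_domainP x : (forall j, padic_int (x j)) ->
  Lp_domain gamma x <-> forall i, pabs (partial_dot x gamma i) = 1.
Proof.
move=> zx; split => [[_ h] i|h]; first by apply/(pdvdPn p_prime) => //; exact: partial_dot_int.
by split => // i; apply/(pdvdPn p_prime) => //; exact: partial_dot_int.
Qed.

(** Moving [x] by less than 1 moves each partial sum by less than 1, which cannot change an absolute
    value equal to 1. *)
Lemma Lp_domain_near x y e : (forall j, padic_int (x j)) -> (forall j, padic_int (y j)) ->
  0 <= e -> e < 1 -> (forall j, pabs (x j - y j) <= e) ->
  Lp_domain gamma x -> Lp_domain gamma y.
Proof.
move=> zx zy e0 e1 xy /(Lp_domainP zx) h; apply/(Lp_domainP zy) => i.
rewrite -(h i); apply: pabs_near; rewrite h (le_lt_trans _ e1)//.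
by rewrite pabs_distC; apply: partial_dot_dist.
Qed.

Lemma pabs_exprz1 (a : K) (n : int) : pabs a = 1 -> pabs (a ^ n) = 1.
Proof.
move=> a1; case: n => n; first by rewrite -exprnP pabsX a1 expr1n.
by rewrite NegzE -exprnN pabsV pabsX a1 expr1n invr1.
Qed.

Lemma Lp_weight_le1 s x : (forall j, padic_int (s j)) -> (forall j, padic_int (x j)) ->
  pabs (Lp_weight s x) <= 1.
Proof.
move=> zs zx; rewrite /Lp_weight; case: ifP => [/asboolP /(Lp_domainP zx) Dx|_].
  apply: pabs_prod_le1 => i _; have zy := partial_dot_int (i := i) zx.
  have [_ za a1] := omegaP p_prime zy (Dx i).
  rewrite pabsM pabs_exprz1 ?pabs_omega// mulr1 padic_pow_le1//.
  - exact: padic_int_le1.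
  - by rewrite (le_trans a1)// -[p%:R^-1]/(p%:R ^- 1) pX_le.
  - exact: padic_intN.
by rewrite pabs0.
Qed.

(** The bound [e <= |q|] freezes both membership in the domain and the [omega] factors; only the
    powers vary, and [padic_pow_dist] controls them. *)
Lemma Lp_weight_dist s t x y e :
  (forall j, padic_int (s j)) -> (forall j, padic_int (t j)) ->
  (forall j, padic_int (x j)) -> (forall j, padic_int (y j)) ->
  0 <= e -> e <= p%:R ^- q_exp p ->
  (forall j, pabs (s j - t j) <= e) -> (forall j, pabs (x j - y j) <= e) ->
  pabs (Lp_weight s x - Lp_weight t y) <= e.
Proof.
move=> zs zt zx zy e0 eq st xy; rewrite /Lp_weight.
have e1 : e < 1 by rewrite (le_lt_trans eq)// pX_lt1.
have -> : `[< Lp_domain gamma y >] = `[< Lp_domain gamma x >].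
  apply/asbool_equiv_eq; split; apply: Lp_domain_near e1 _ => // j.
  by rewrite pabs_distC.
case: ifP => [/asboolP Dx|_]; last by rewrite subrr pabs0.
have /(Lp_domainP zy) Dy := Lp_domain_near zx zy e0 e1 xy Dx.
move: Dx => /(Lp_domainP zx) Dx.
have F i : let u := partial_dot x gamma i in let v := partial_dot y gamma i in
    [/\ pabs (padic_pow (angle u) (- s i)) <= 1, pabs (padic_pow (angle v) (- t i)) <= 1,
      pabs (omega u) = 1, omega u = omega v &
      pabs (padic_pow (angle u) (- s i) - padic_pow (angle v) (- t i)) <= e].
  move=> u v; have zu : padic_int u := partial_dot_int (i := i) zx.
  have zv : padic_int v := partial_dot_int (i := i) zy.
  have uv : pabs (u - v) <= e by apply: partial_dot_dist.
  have uvq := le_trans uv eq.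
  have [_ zau au] := omegaP p_prime zu (Dx i).
  have [_ zav av] := omegaP p_prime zv (Dy i).
  have q1 : p%:R ^- q_exp p <= p%:R^-1 :> R by rewrite -[p%:R^-1]/(p%:R ^- 1) pX_le.
  have aup := le_trans au q1; have avp := le_trans av q1.
  split.
  - by apply: padic_pow_le1 => //; [exact: padic_int_le1|exact: padic_intN].
  - by apply: padic_pow_le1 => //; [exact: padic_int_le1|exact: padic_intN].
  - exact: (pabs_omega p_prime zu (Dx i)).
  - exact: (omega_near p_prime zu (Dx i) zv (Dy i) uvq).
  - apply: (padic_pow_dist p_prime) => //; try exact: padic_int_le1; try exact: padic_intN.
      by rewrite (angle_dist p_prime zu (Dx i) zv (Dy i) uvq).
    by rewrite -opprD pabsN.
apply: pabs_dist_prod => // i _; have [pu pv ou ouv puv] := F i.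
- by rewrite pabsM pabs_exprz1// mulr1.
- by rewrite pabsM -ouv pabs_exprz1// mulr1.
- by rewrite -ouv -mulrBl pabsM pabs_exprz1// mulr1.
Qed.

End Integrand.

(** * Geometric sums and partial fractions over roots of unity *)

Section RootsOfUnity.
Context (F : fieldType).
Implicit Types (u z : F).

Lemma sum_unity_root u c : u ^+ c = 1 -> u != 1 -> \sum_(i < c) u ^+ i = 0.
Proof.
move=> uc u1; have u10 : u - 1 != 0 by rewrite subr_eq0.
by apply: (mulfI u10); rewrite -subrX1 uc subrr mulr0.
Qed.

Lemma sum_modn_eq (f : nat -> F) P Q j : (j < P)%N ->
  \sum_(m < Q * P | (m %% P == j)%N) f m = \sum_(i < Q) f (i * P + j)%N.
Proof.
move=> jP; rewrite big_mkcond -(big_mkord xpredT (fun m => if (m %% P == j)%N then f m else 0)).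
rewrite big_nat_mul big_mkord; apply: eq_bigr => i _.
rewrite -{1}[(i * P)%N]add0n big_addn mulSn addnK big_mkord -big_mkcond/=.
rewrite (big_pred1 (Ordinal jP)) ?[(i * P + j)%N]addnC// => m.
by rewrite addnC modnMDl modn_small// -val_eqE.
Qed.

(** Finite additivity of the measure attached to [z]: writing [m = i P + j] leaves a geometric
    series in [z^P]. *)
Lemma mu_sum (z : F) P Q j : (j < P)%N -> z ^+ (Q * P) != 1 ->
  \sum_(m < Q * P | (m %% P == j)%N) z ^+ m / (1 - z ^+ (Q * P)) = z ^+ j / (1 - z ^+ P).
Proof.
move=> jP zQ; rewrite (sum_modn_eq (fun m => z ^+ m / (1 - z ^+ (Q * P)))) //.
have zQ0 : 1 - z ^+ (Q * P) != 0 by rewrite subr_eq0 eq_sym.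
have zP0 : 1 - z ^+ P != 0.
  rewrite subr_eq0 eq_sym; apply: contra zQ => /eqP zP.
  by rewrite mulnC exprM zP expr1n.
apply: (mulIf zP0); apply: (mulIf zQ0).
rewrite mulr_suml mulr_suml.
under eq_bigr => i _ do rewrite mulrAC divfK// exprD mulnC exprM.
rewrite divfK// mulnC exprM -[1 - (z ^+ P) ^+ Q]opprB subrX1 -mulNr opprB.
by rewrite mulrCA !mulr_sumr; apply: eq_bigr => i _; ring.
Qed.

Context (c : nat) (z : F) (z_prim : c.-primitive_root z).

Let root_neq1 i : (0 < i < c)%N -> z ^+ i != 1.
Proof.
move=> /andP[i0 ic]; rewrite -(prim_order_dvd z_prim).
by apply/negP => /(dvdn_leq i0); rewrite leqNgt ic.
Qed.

Lemma prim_root_sumX a : (0 < a < c)%N -> \sum_(1 <= i < c) (z ^+ i) ^+ a = -1.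
Proof.
move=> ac; have c0 : (0 < c)%N by case/andP: ac; case: (c).
have : \sum_(i < c) (z ^+ a) ^+ i = 0.
  apply: sum_unity_root; last exact: root_neq1.
  by rewrite exprAC (prim_expr_order z_prim) expr1n.
rewrite -(big_mkord xpredT (fun i => (z ^+ a) ^+ i)) big_ltn// expr0 => /eqP.
rewrite addrC addr_eq0 => /eqP <-.
by apply: eq_bigr => i _; rewrite exprAC.
Qed.

Let S a := \sum_(1 <= i < c) (z ^+ i) ^+ a / (1 - z ^+ i).

(** For each root [u], the difference [(u^(a+1) - u^a) / (1 - u)] is [- u^a], and [prim_root_sumX]
    sums the [u^a] to -1. *)
Let S_step a : (0 < a < c)%N -> S a.+1 = S a + 1.
Proof.
move=> ac; apply: (canRL (subrKC _)); rewrite -[1]opprK -(prim_root_sumX ac) /S.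
rewrite -sumrB -sumrN [LHS]big_nat [RHS]big_nat; apply: eq_bigr => i /root_neq1 zi.
by move: (z ^+ i) zi => u u1; rewrite exprS; field; rewrite subr_eq0 eq_sym.
Qed.

(** For each root, the exponents run over a full period. This fixes the constant left open by
    [S_step]. *)
Let S_sum : \sum_(1 <= a < c.+1) S a = 0.
Proof.
rewrite /S exchange_big_nat/= big_nat big1// => i /root_neq1 zi.
rewrite -mulr_suml (big_addn 0 _ 1) subn1/=.
under eq_bigr => j _ do rewrite addn1 exprS.
rewrite -mulr_sumr big_mkord sum_unity_root ?mulr0 ?mul0r//.
by rewrite exprAC (prim_expr_order z_prim) expr1n.
Qed.

Let S_lin a : (a < c)%N -> S a.+1 = S 1 + a%:R.
Proof.
elim: a => [|a IH] ac; first by rewrite addr0.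
by rewrite S_step ?ac// IH ?(ltnW ac)// -natr1 addrA.
Qed.

(** [S] is an arithmetic progression of step 1 with sum 0 over [1..c], so [S a = a - (c + 1) / 2];
    it is doubled to avoid dividing by 2 in a general field. *)
Lemma prim_root_sum_frac a : (0 < a <= c)%N ->
  2%:R * \sum_(1 <= i < c) (z ^+ i) ^+ a / (1 - z ^+ i) = (2 * a)%:R - c%:R - 1.
Proof.
case: a => [//|a] /= ac; rewrite -/(S a.+1) S_lin//.
(* A primitive [c]-th root of unity forces [c] to be nonzero in the field, so [c] cancels below. *)
have cN0 := prim_root_natf_neq0 z_prim.
have : \sum_(i < c) (S 1 + i%:R) = 0.
  rewrite -[RHS]S_sum (big_addn 0 _ 1) subn1 big_mkord/=.
  by apply: eq_bigr => i _; rewrite addn1 [RHS]S_lin.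
have sumn n : 2%:R * \sum_(i < n) (S 1 + i%:R) = n%:R * (2%:R * S 1 + n%:R - 1).
  elim: n => [|n IH]; first by rewrite big_ord0 mulr0 mul0r.
  by rewrite big_ord_recr/= mulrDr IH -natr1; ring.
move=> h; have := sumn c; rewrite h mulr0 => /esym/eqP.
rewrite mulf_eq0 (negbTE cN0)/= => /eqP S1.
have -> : 2%:R * (S 1 + a%:R) = (2%:R * S 1 + c%:R - 1) + (2%:R * a%:R - c%:R + 1) by ring.
by rewrite S1 natrM -natr1; ring.
Qed.

End RootsOfUnity.

(** * The regularized measure: additivity, values, bound and dependence on c *)

Section RegularizedMeasure.
Context (R : realType) (p : nat) (p_prime : prime p) (K : padicComplexType R p).

(** Since [c] is nonzero in [K], [X^c - 1] is separable; it splits into [c] distinct roots, and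
    these contain a primitive one. *)
Lemma prim_root_exists c : (0 < c)%N -> exists z : K, c.-primitive_root z.
Proof.
move=> c0; have [rs] := closed_field_poly_normal ('X^c - 1 : {poly K}).
rewrite (monicP _) ?monicXnsubC// scale1r => rsE.
have rs1 : all c.-unity_root rs by apply/allP => z; rewrite -root_prod_XsubC -rsE.
have sz_rs : (c < (size rs).+1)%N by rewrite -(size_prod_XsubC rs id) -rsE size_XnsubC.
have [|z _ z_prim] := hasP (has_prim_root c0 rs1 _ sz_rs); last by exists z.
by rewrite -separable_prod_XsubC -rsE separable_Xn_sub_1 ?nat_neq0.
Qed.

Lemma mu_tildeE c (z : K) N j : (1 < c)%N -> c.-primitive_root z ->
  mu_tilde c N j = \sum_(1 <= i < c) mu_z (z ^+ i) N j.
Proof.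
move=> c1 z_prim; pose zs := [seq z ^+ i | i <- index_iota 1 c].
have zs_uniq : uniq zs.
  rewrite map_inj_in_uniq ?iota_uniq// => i i'.
  rewrite !mem_index_iota => /andP[_ ic] /andP[_ i'c] /eqP.
  by rewrite (eq_prim_root_expr z_prim) !modn_small// => /eqP.
rewrite -(big_map (fun i => z ^+ i) xpredT (fun x => mu_z x N j)) -/zs.
rewrite (fsbig_seq _ _ zs_uniq) /mu_tilde; congr (\big[_/_]_(_ \in _) _).
rewrite predeqE => x /=; split => [[xc x1]|/mapP[i]].
  have [i xE] := prim_rootP z_prim xc; apply/mapP; exists (nat_of_ord i) => //.
  rewrite mem_index_iota ltn_ord andbT lt0n; apply/eqP => i0.
  by move: x1; rewrite xE i0 expr0 eqxx.
rewrite mem_index_iota => /andP[i0 ic] ->; split.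
  by rewrite exprAC (prim_expr_order z_prim) expr1n.
rewrite -(prim_order_dvd z_prim); apply/negP => /(dvdn_leq i0).
by rewrite leqNgt ic.
Qed.

(** Additivity holds root by root through [mu_sum]; as [c] is prime to [p], no nontrivial [c]-th
    root of unity becomes 1 when raised to the power [p^M]. *)
Lemma mu_tilde_refine c M N j : (1 < c)%N -> coprime c p -> (N <= M)%N -> (j < p ^ N)%N ->
  mu_tilde c N j = \sum_(m < p ^ M | (m %% p ^ N == j)%N) mu_tilde c M m :> K.
Proof.
move=> c1 cp NM jN; have [z z_prim] := prim_root_exists (ltnW c1).
rewrite (mu_tildeE _ _ c1 z_prim).
under [RHS]eq_bigr do rewrite (mu_tildeE _ _ c1 z_prim).
rewrite exchange_big/= [LHS]big_nat [RHS]big_nat; apply: eq_bigr => i /andP[i0 ic].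
have zi1 : (z ^+ i) ^+ (p ^ M) != 1.
  rewrite -exprM -(prim_order_dvd z_prim) Gauss_dvdl ?coprimeXr//.
  by apply/negP => /(dvdn_leq i0); rewrite leqNgt ic.
have pE : (p ^ M = p ^ (M - N) * p ^ N)%N by rewrite -expnD subnK.
by rewrite /mu_z; rewrite pE in zi1 *; rewrite mu_sum.
Qed.

Lemma frac_index c P j : (0 < c)%N -> coprime P c -> (j < P)%N ->
  exists a t, [/\ (0 < a <= c)%N, (0 < t <= P)%N & (a * P = j + c * t)%N].
Proof.
move=> c0 Pc jP; have P0 : (0 < P)%N := leq_ltn_trans (leq0n j) jP.
have [[u v] /= uv] := coprimeP _ P0 Pc.
have uE : (u * P = 1 + v * c)%N by rewrite -uv subnK// ltnW// -subn_gt0 uv.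
(* [u] inverts [P] modulo [c]. The residue 0 is replaced by [c], so that [a P >= P > j] and [t] is
   positive. *)
pose a0 := ((j * u) %% c)%N; pose a := if a0 == 0%N then c else a0.
have a_range : (0 < a <= c)%N.
  rewrite /a; case: eqP => [_|/eqP]; first by rewrite c0 leqnn.
  by rewrite -lt0n => ->; rewrite ltnW// ltn_mod.
have aP : (a * P = j %[mod c])%N.
  have : (a = j * u %[mod c])%N.
    by rewrite /a -/a0; case: eqP => [h|_]; rewrite ?modnn ?modn_mod// -h.
  move=> h; rewrite -modnMml h modnMml -mulnA uE mulnDr muln1.
  by rewrite mulnA addnC modnMDl.
have ja : (j < a * P)%N.
  by case/andP: a_range => a1 _; rewrite (leq_trans jP)// leq_pmull.
have /dvdnP[t tE] : (c %| a * P - j)%N by rewrite -eqn_mod_dvd ?aP// ltnW.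
exists a, t; split => //; last by rewrite [(c * t)%N]mulnC -tE subnKC// ltnW.
apply/andP; split.
  by have : (0 < t * c)%N; [rewrite -tE subn_gt0|rewrite muln_gt0 => /andP[]].
rewrite -(leq_pmul2r c0) -tE (leq_trans (leq_subr _ _))// mulnC leq_pmul2l//.
by case/andP: a_range.
Qed.

(** As [c] is prime to [p], [z^(p^N)] is again a primitive root, and [z^j] is its [a]-th power since
    [a p^N = j] modulo [c]. This brings the sum to the form of [prim_root_sum_frac]. *)
Lemma mu_tilde_val c N j : (1 < c)%N -> coprime c p -> (j < p ^ N)%N ->
  exists a t : nat, [/\ (0 < t <= p ^ N)%N, (a * p ^ N = j + c * t)%N &
    2%:R * mu_tilde c N j = (2 * a)%:R - c%:R - 1 :> K].
Proof.
move=> c1 cp jN; have c0 := ltnW c1; have [z z_prim] := prim_root_exists c0.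
have pNc : coprime (p ^ N) c by rewrite coprime_sym coprimeXr.
have [a [t [ac tN aE]]] := frac_index c0 pNc jN; exists a, t; split => //.
have zN_prim : c.-primitive_root (z ^+ (p ^ N)) by rewrite prim_root_exp_coprime.
rewrite -(prim_root_sum_frac zN_prim ac) (mu_tildeE _ _ c1 z_prim); congr (_ * _).
apply: eq_bigr => i _; rewrite /mu_z [z ^+ i ^+ (p ^ N)]exprAC; congr (_ / _).
rewrite -!exprM mulnCA [(p ^ N * a)%N]mulnC aE mulnDr mulnCA.
by rewrite exprD [z ^+ (c * _)]exprM (prim_expr_order z_prim) expr1n mulr1.
Qed.

(** Dividing by 2 costs at most one factor [p], whatever the parity of [p]. *)
Lemma pabs2 : p%:R^-1 <= pabs (2%:R : K).
Proof.
case: (boolP (p %| 2)%N) => [|h].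
  by rewrite dvdn_prime2// => /eqP p2; rewrite -(pabs_p (s := K)) -p2.
rewrite pabs_coprime ?invf_le1 ?p_gt0 ?ltW ?p_gt1//.
by rewrite coprime_sym prime_coprime.
Qed.

Lemma pabs2_gt0 : 0 < pabs (2%:R : K).
Proof. by rewrite pabs_gt0 (nat_neq0 p_prime). Qed.

(** In [2 mu = 2 a - (c + 1)], either [c] is odd and 2 divides [c + 1], or [c] is even, so that [p]
    is odd and 2 is a unit. *)
Lemma mu_tilde_le1 c N j : (1 < c)%N -> coprime c p -> (j < p ^ N)%N ->
  pabs (mu_tilde c N j : K) <= 1.
Proof.
move=> c1 cp jN; have [a [t [_ _ mE]]] := mu_tilde_val c1 cp jN.
rewrite -(ler_pM2l pabs2_gt0) mulr1 -pabsM mE natrM -addrA -opprD pabsB_le//.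
  by rewrite pabsM ler_piMr ?pabs_ge0// pabs_nat_le1.
rewrite natr1; case: (boolP (2 %| c.+1)%N) => [/dvdnP[m ->]|].
  by rewrite natrM pabsM ler_piMl ?pabs_ge0// pabs_nat_le1.
rewrite dvdn2/= negbK => c_even; rewrite [leRHS]pabs_coprime ?pabs_nat_le1//.
by rewrite (coprime_dvdl _ cp)// dvdn2.
Qed.

(* The integers [t] of [mu_tilde_val] agree for [c] and [c'], since [c t = - j]
   modulo [p ^ N]; hence [(a - a') p ^ N = (c - c') t]. *)
Lemma mu_tilde_dist c c' M N j :
  (1 < c)%N -> coprime c p -> (1 < c')%N -> coprime c' p -> (j < p ^ N)%N ->
  pabs (c%:R - c'%:R : K) <= p%:R ^- (N + M).+1 ->
  pabs (mu_tilde c N j - mu_tilde c' N j : K) <= p%:R ^- M.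
Proof.
move=> c1 cp c'1 c'p jN cc'.
have [a [t [tN aE mE]]] := mu_tilde_val c1 cp jN.
have [a' [t' [t'N a'E m'E]]] := mu_tilde_val c'1 c'p jN.
have aK : a%:R * (p ^ N)%:R = j%:R + c%:R * t%:R :> K by rewrite -!natrM -natrD aE.
have a'K : a'%:R * (p ^ N)%:R = j%:R + c'%:R * t'%:R :> K by rewrite -!natrM -natrD a'E.
have tt' : t = t'.
  have : pabs (t%:R - t'%:R : K) <= p%:R ^- N.
    rewrite -[leLHS]mul1r -[X in X * _ <= _](pabs_coprime p_prime K cp) -pabsM.
    have -> : c%:R * (t%:R - t'%:R) =
        (p ^ N)%:R * (a%:R - a'%:R) - (c%:R - c'%:R) * t'%:R :> K.
      by rewrite mulrC mulrBl mulrBr [X in X - _ - _]mulrC [X in _ - X - _]mulrC aK a'K; ring.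
    rewrite pabsB_le// pabsM.
      by rewrite pabs_pX ler_piMr ?pabsB_le ?pabs_nat_le1// ltW// pX_gt0.
    rewrite -[leRHS]mulr1 ler_pM ?pabs_ge0 ?pabs_nat_le1//.
    by rewrite (le_trans cc')// pX_le// leqW// leq_addr.
  rewrite (pabs_natB_le p_prime) => /eqP.
  (* Both numbers lie in [1..p^N], where [p^N] alone has residue 0; congruence therefore gives
     equality. *)
  case/andP: tN => t0; rewrite leq_eqVlt; case/andP: t'N => t'0; rewrite leq_eqVlt.
  case/predU1P => [->|t'N] /predU1P[->|tN] //; rewrite ?modnn ?(modn_small tN) ?(modn_small t'N)//.
    by move=> t00; rewrite t00 in t0.
  by move=> t00; rewrite -t00 in t'0.
rewrite -{}tt' {t' t'N} in a'E a'K.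
have aa' : pabs (a%:R - a'%:R : K) <= p%:R ^- M.+1.
  rewrite -(ler_pM2l (pX_gt0 R p_prime N)) -{1}(pabs_pX K) -pabsM.
  have -> : (p ^ N)%:R * (a%:R - a'%:R) = (c%:R - c'%:R) * t%:R :> K.
    by rewrite mulrC mulrBl aK a'K; ring.
  rewrite pabsM -invfM -exprD mulrC addnS (le_trans (ler_piMl (pabs_ge0 _) _)) ?pabs_nat_le1//.
rewrite -(ler_pM2l pabs2_gt0) -pabsM.
have -> : 2%:R * (mu_tilde c N j - mu_tilde c' N j) =
    2%:R * (a%:R - a'%:R) - (c%:R - c'%:R) :> K.
  by rewrite mulrBr mE m'E !natrM; ring.
(* The spare factor [1/p] pays for the division by 2. *)
apply: (@le_trans _ _ (p%:R ^- M.+1)); last first.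
  by rewrite exprS invfM ler_wpM2r ?pabs2// ltW// pX_gt0.
rewrite pabsB_le//; last by rewrite (le_trans cc')// pX_le// ltnS leq_addl.
by rewrite pabsM (le_trans (ler_piMl (pabs_ge0 _) _))// pabs_nat_le1.
Qed.

End RegularizedMeasure.

(** * Riemann sums, the integral and its extension to p-adic units c *)

Section Integral.
Context (R : realType) (p : nat) (p_prime : prime p) (K : padicComplexType R p).
Context (r : nat) (k : 'I_r -> int) (gamma : 'I_r -> K).
Context (gammaZp : forall j, padic_int (gamma j)).
Implicit Types (s t : 'I_r -> K) (c N M : nat).

Let sample n (m : {ffun 'I_r -> 'I_n}) : 'I_r -> K := fun j => (m j : nat)%:R.

Let sample_int n (m : {ffun 'I_r -> 'I_n}) j : padic_int (sample m j).
Proof. exact: padic_int_nat. Qed.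

Let pX0 N : (0 < p ^ N)%N.
Proof. by rewrite expn_gt0 prime_gt0. Qed.

Let reduce N M (m : {ffun 'I_r -> 'I_(p ^ M)}) : {ffun 'I_r -> 'I_(p ^ N)} :=
  [ffun j => Ordinal (ltn_pmod (m j) (pX0 N))].

Definition Lp_sum s c N : K :=
  \sum_(m : {ffun 'I_r -> 'I_(p ^ N)})
    Lp_weight k gamma s (sample m) * \prod_(j < r) mu_tilde c N (m j).

Lemma Lp_sumE s c :
  Lp s k gamma c = lim (Lp_sum s c N @[N --> \oo]).
Proof.
have <- : riemann_sum (mu_tilde c) (Lp_domain gamma) (Lp_integrand k gamma s) =
    Lp_sum s c; last by [].
apply/funext => N; rewrite /riemann_sum big_mkcond; apply: eq_bigr => m _.
by rewrite /Lp_weight; case: ifP => _; rewrite ?mul0r.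
Qed.

(** Additivity in each coordinate, expanded over the product, splits every ball of level [N] into
    balls of level [M] that keep its sample point. Sums of two levels then share one index set. *)
Lemma Lp_sum_refine s c N M : (1 < c)%N -> coprime c p -> (N <= M)%N ->
  Lp_sum s c N = \sum_(m : {ffun 'I_r -> 'I_(p ^ M)})
    Lp_weight k gamma s (sample (reduce N m)) * \prod_(j < r) mu_tilde c M (m j).
Proof.
move=> c1 cp NM; rewrite [RHS](partition_big (@reduce N M) xpredT)//=.
apply: eq_bigr => n _.
have -> : \prod_(j < r) mu_tilde c N (n j) =
    \prod_(j < r) \sum_(m < p ^ M | (m %% p ^ N == n j)%N) mu_tilde c M m :> K.
  by apply: eq_bigr => j _; apply: mu_tilde_refine.
rewrite (bigA_distr_big_dep (fun j (m : 'I_(p ^ M)) => m %% p ^ N == n j)%N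
  (fun (j : 'I_r) (m : 'I_(p ^ M)) => mu_tilde c M m))/= mulr_sumr.
apply: eq_big => [m|m /familyP mn].
  apply/familyP/eqP => [mn|<- j]; last by rewrite -topredE /= ffunE.
  by apply/ffunP => j; apply/val_inj; rewrite ffunE /=; apply/eqP/mn.
congr (Lp_weight _ _ _ (sample _) * _); apply/ffunP => j; apply/val_inj.
by rewrite ffunE /=; apply/esym/eqP/mn.
Qed.

Lemma pabs_prod_mu_le1 c N (m : {ffun 'I_r -> 'I_(p ^ N)}) :
  (1 < c)%N -> coprime c p -> pabs (\prod_(j < r) mu_tilde c N (m j) : K) <= 1.
Proof. by move=> c1 cp; apply: pabs_prod_le1 => j _; apply: mu_tilde_le1. Qed.

Lemma Lp_sum_cauchy s c N M : (forall j, padic_int (s j)) -> (1 < c)%N -> coprime c p ->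
  (q_exp p <= N <= M)%N -> pabs (Lp_sum s c M - Lp_sum s c N) <= p%:R ^- N.
Proof.
move=> zs c1 cp /andP[qN NM]; rewrite (Lp_sum_refine s c1 cp NM) -sumrB.
have pN0 := ltW (pX_gt0 R p_prime N).
apply: pabs_sum => // m _; rewrite -mulrBl pabsM -[leRHS]mulr1.
rewrite ler_pM ?pabs_ge0 ?pabs_prod_mu_le1// Lp_weight_dist ?pX_le// => j.
  by rewrite subrr pabs0.
by rewrite (pabs_natB_le p_prime) ffunE/= modn_mod.
Qed.

Lemma Lp_sum_cvg s c : (forall j, padic_int (s j)) -> (1 < c)%N -> coprime c p ->
  Lp_sum s c N @[N --> \oo] --> Lp s k gamma c.
Proof.
move=> zs c1 cp; have [|l sl] := @cauchy_pabs _ _ K (Lp_sum s c).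
  move=> e e0; have [N Ne] := exists_pX_lt p_prime e0.
  exists (maxn (q_exp p) N) => M NM.
  rewrite (le_trans (Lp_sum_cauchy _ _ _ _)) ?leq_maxl//.
  by rewrite (le_trans _ (ltW Ne))// pX_le// leq_maxr.
by rewrite Lp_sumE (cvg_lim (metric_hausdorff (T := K)) sl).
Qed.

(** The Cauchy estimate involves neither [s] nor [c], so the Riemann sums converge uniformly in
    both. *)
Lemma Lp_sum_approx s c N : (forall j, padic_int (s j)) -> (1 < c)%N -> coprime c p ->
  (q_exp p <= N)%N -> pabs (Lp s k gamma c - Lp_sum s c N) <= p%:R ^- N.
Proof.
move=> zs c1 cp qN; apply: (cvg_pabs_le (N := N) (Lp_sum_cvg zs c1 cp)) => M NM.
by rewrite Lp_sum_cauchy// qN.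
Qed.

(** Both integrals are replaced by their Riemann sums of level [M]; the exponent [(M + M).+1] is
    what [mu_tilde_dist] asks at level [M] for precision [p^-M]. *)
Lemma Lp_nat_dist s t c c' M :
  (forall j, padic_int (s j)) -> (forall j, padic_int (t j)) ->
  (1 < c)%N -> coprime c p -> (1 < c')%N -> coprime c' p -> (q_exp p <= M)%N ->
  (forall j, pabs (s j - t j) <= p%:R ^- M) ->
  pabs (c%:R - c'%:R : K) <= p%:R ^- (M + M).+1 ->
  pabs (Lp s k gamma c - Lp t k gamma c') <= p%:R ^- M.
Proof.
move=> zs zt c1 cp c'1 c'p qM st cc'.
apply: (@pdist_le _ _ _ (Lp_sum s c M)); first exact: Lp_sum_approx.
apply: (@pdist_le _ _ _ (Lp_sum t c' M)); last by rewrite pabs_distC Lp_sum_approx.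
have pM0 := ltW (pX_gt0 R p_prime M).
rewrite -sumrB pabs_sum// => m _; rewrite pabs_distM_le ?Lp_weight_le1 ?pabs_prod_mu_le1//.
  by rewrite Lp_weight_dist ?pX_le// => j; rewrite subrr pabs0.
by apply: pabs_dist_prod => // j _; rewrite ?mu_tilde_le1 ?mu_tilde_dist.
Qed.

(** The value at [c] is characterized by its distance to the values at nearby admissible natural
    numbers, with the explicit modulus of [Lp_nat_dist]. *)
Definition Lp_limit s (c : K) : set K :=
  [set l | forall M n, (q_exp p <= M)%N -> (1 < n)%N -> coprime n p ->
    pabs (c - n%:R) <= p%:R ^- (M + M).+1 -> pabs (l - Lp s k gamma n) <= p%:R ^- M].

Definition Lp_ext s (c : K) : K := get (Lp_limit s c).

(** Along natural numbers [u M] tending to [c] at the prescribed rate, the values form a Cauchy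
    sequence, and its limit meets every constraint of [Lp_limit]. *)
Lemma Lp_ext_approx s (c : K) : (forall j, padic_int (s j)) -> padic_unit c ->
  Lp_limit s c (Lp_ext s c).
Proof.
move=> zs /(padic_unitP p_prime)[zc c1]; apply: getPex.
have /choice[u uP] : forall M, exists n : nat,
    [/\ (1 < n)%N, coprime n p & pabs (c - n%:R) <= p%:R ^- (M + M).+1].
  move=> M; have [n n1 cn] := padic_int_approx p_prime (M + M).+1 zc.
  by exists n; split => //; apply: padic_int_coprime cn.
have near M m n : (q_exp p <= M <= m)%N -> (1 < n)%N -> coprime n p ->
    pabs (c - n%:R) <= p%:R ^- (M + M).+1 ->
    pabs (Lp s k gamma (u m) - Lp s k gamma n) <= p%:R ^- M.
  move=> /andP[qM Mm] n1 np cn; have [um1 ump cum] := uP m.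
  apply: Lp_nat_dist => //; first by move=> j; rewrite subrr pabs0 ltW// pX_gt0.
  apply: (@pdist_le _ _ _ c) => //.
  by rewrite pabs_distC (le_trans cum)// pX_le// ltnS leq_add.
have [|l ul] := @cauchy_pabs _ _ K (fun m => Lp s k gamma (u m)).
  move=> e e0; have [N Ne] := exists_pX_lt p_prime e0.
  exists (maxn (q_exp p) N) => m Nm.
  have [u1 up cu] := uP (maxn (q_exp p) N).
  rewrite (le_trans (near (maxn (q_exp p) N) _ _ _ _ _ _)) ?leq_maxl//.
  by rewrite (le_trans _ (ltW Ne))// pX_le// leq_maxr.
exists l => M n qM n1 np cn; apply: (cvg_pabs_le (N := M) ul) => m Mm.
by apply: near => //; rewrite qM.
Qed.

(** The number [c] is itself an admissible approximation, at distance 0 for every precision. *)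
Lemma Lp_ext_nat s c : (forall j, padic_int (s j)) -> (1 < c)%N -> coprime c p ->
  Lp_ext s c%:R = Lp s k gamma c.
Proof.
move=> zs c1 cp; apply: pabs_le_eq => e e0; have [N Ne] := exists_pX_lt p_prime e0.
apply: (@le_trans _ _ (p%:R ^- maxn (q_exp p) N)).
  apply: Lp_ext_approx; rewrite ?leq_maxl ?subrr ?pabs0//; last first.
    by rewrite ltW// pX_gt0.
  by apply/(padic_unitP p_prime); split; [exact: padic_int_nat|exact: pabs_coprime].
by rewrite (le_trans _ (ltW Ne))// pX_le// leq_maxr.
Qed.

(** Natural numbers [n] and [n'] replace [c] and [c']; by the ultrametric inequality they are as
    close as [c] and [c'] were required to be, so the modulus is unchanged. *)
Lemma Lp_ext_dist s t (c c' : K) M :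
  (forall j, padic_int (s j)) -> (forall j, padic_int (t j)) ->
  padic_unit c -> padic_unit c' -> (q_exp p <= M)%N ->
  (forall j, pabs (s j - t j) <= p%:R ^- M) ->
  pabs (c - c') <= p%:R ^- (M + M).+1 ->
  pabs (Lp_ext s c - Lp_ext t c') <= p%:R ^- M.
Proof.
move=> zs zt uc uc' qM st cc'.
have approx a : padic_unit a -> exists n : nat,
    [/\ (1 < n)%N, coprime n p & pabs (a - n%:R : K) <= p%:R ^- (M + M).+1].
  move=> /(padic_unitP p_prime)[za a1].
  have [n n1 cn] := padic_int_approx p_prime (M + M).+1 za.
  by exists n; split => //; apply: padic_int_coprime cn.
have [n [n1 np cn]] := approx _ uc; have [n' [n'1 n'p cn']] := approx _ uc'.
apply: (@pdist_le _ _ _ (Lp s k gamma n)); first exact: Lp_ext_approx.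
apply: (@pdist_le _ _ _ (Lp t k gamma n')); last by rewrite pabs_distC Lp_ext_approx.
apply: Lp_nat_dist => //; apply: (@pdist_le _ _ _ c); first by rewrite pabs_distC.
exact: (@pdist_le _ _ _ c').
Qed.

Lemma Lp_ext_unif (eps : R) : 0 < eps -> exists2 delta : R, 0 < delta &
  forall (c c' : K) s t, padic_unit c -> padic_unit c' -> pabs (c - c') < delta ->
    (forall j, padic_int (s j)) -> (forall j, padic_int (t j)) ->
    (forall j, pabs (s j - t j) < delta) -> pabs (Lp_ext s c - Lp_ext t c') < eps.
Proof.
move=> e0; have [N Ne] := exists_pX_lt p_prime e0; pose M := maxn (q_exp p) N.
(* This is the modulus for [c]; being at most [p^-M], it serves for the [s j] too. *)
exists (p%:R ^- (M + M).+1); first exact: pX_gt0.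
move=> c c' s t uc uc' cc' zs zt st.
apply: (@le_lt_trans _ _ (p%:R ^- M)).
  apply: Lp_ext_dist; rewrite ?leq_maxl ?ltW// => j.
  by rewrite (le_trans (ltW (st j)))// pX_le// leqW// leq_addr.
by rewrite (le_lt_trans _ Ne)// pX_le// leq_maxr.
Qed.

Lemma Lp_ext_continuous s : (forall j, padic_int (s j)) ->
  {within @padic_unit R p K, continuous (Lp_ext s)}.
Proof.
move=> zs; apply/subspace_continuousP => c uc.
apply/metricType_numDomainType.cvgrPdist_lt => e e0.
have [d d0 H] := Lp_ext_unif e0.
apply/nbhs_ballP; exists d => //= c'.
rewrite ballEmdist/= mdist_pabs => cc' uc'.
by rewrite mdist_pabs H// => j; rewrite subrr pabs0.
Qed.

End Integral.

Theorem theorem2p17 (R : realType) (p : nat) (p_prime : prime p)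
    (K : padicComplexType R p) (r : nat) (r_gt0 : (0 < r)%N)
    (k : 'I_r -> int) (gamma : 'I_r -> K)
    (gammaZp : forall j, padic_int (gamma j)) :
  exists L : ('I_r -> K) -> K -> K,
    (forall s : 'I_r -> K, (forall j, padic_int (s j)) ->
       {within @padic_unit R p K, continuous (L s)} /\
       (forall c : nat, (1 < c)%N -> coprime c p ->
          L s c%:R = Lp s k gamma c)) /\
    (forall eps : R, 0 < eps -> exists2 delta : R, 0 < delta &
       forall (c c' : K) (s s' : 'I_r -> K),
         padic_unit c -> padic_unit c' -> pabs (c - c') < delta ->
         (forall j, padic_int (s j)) -> (forall j, padic_int (s' j)) ->
         (forall j, pabs (s j - s' j) < delta) ->
         pabs (L s c - L s' c') < eps).
Proof.
exists (Lp_ext k gamma); split; last exact: Lp_ext_unif.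
move=> s zs; split; first exact: Lp_ext_continuous.
by move=> c c1 cp; apply: Lp_ext_nat.
Qed.
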